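(* Let $p$ be a prime, $n\ge1$, and let $\sigma\in\mathcal{B}_n(\mathbb{F}_p)$. Then: (1) there exists a $\mathbb{Z}$-flow $\sigma_T\in\mathcal{B}(S_1R_0,S_2R_1,\ldots,S_nR_{n-1})$ of $\sigma$; (2) $\sigma_T\in\mathcal{B}(W_1,\ldots,W_n)$, where $W_i:=S_{i-1}R_{i-1}+\mathbb{F}_pQ_{i-1}$ for $1\le i\le n$.
   Context: $R_j:=\mathbb{F}_p[X_1,\ldots,X_j]/(X_1^p-X_1,\ldots,X_j^p-X_j)=\mathbb{F}_p[x_1,\ldots,x_j]$ is identified with the ring of functions $\mathbb{F}_p^j\to\mathbb{F}_p$ ($R_0=\mathbb{F}_p$). $\mathcal{B}_n(\mathbb{F}_p)$ is the group (under composition) of all permutations of $\mathbb{F}_p^n$ of the form $(x_1+g_1,\ldots,x_n+g_n)$ with $g_i\in R_{i-1}$. For $i\ge0$, $S_i:=\mathbb{F}_p[Q_0,\ldots,Q_{i-1}]$ with relations $Q_j^p=Q_j$ for $0\le j\le i-1$ (so $S_0=\mathbb{F}_p$); it is identified with a ring of functions $\mathbb{Z}\to\mathbb{F}_p$ via $Q_j(m)=\binom{m}{p^j}\bmod p$ for $m\in\mathbb{Z}$. $S_iR_j:=S_i\otimes_{\mathbb{F}_p}R_j=S_i[x_1,\ldots,x_j]$ (with $x_l^p=x_l$). For additive subgroups $V_i\subseteq S_nR_{i-1}$ ($1\le i\le n$), $\mathcal{B}(V_1,\ldots,V_n)$ denotes the set of all $(x_1+g_1,\ldots,x_n+g_n)$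 with $g_i\in V_i$. For $m\in\mathbb{Z}$, $\varphi_m$ replaces each $Q_j$ by $Q_j(m)\in\mathbb{F}_p$ in the coefficients, so that $\varphi_m(\sigma_T)$ is a map $\mathbb{F}_p^n\to\mathbb{F}_p^n$. $\sigma_T$ is a $\mathbb{Z}$-flow of $\sigma$ if $\varphi_m(\sigma_T)=\sigma^m$ for all $m\in\mathbb{N}$. *)

(* Defs.v *)
From HB Require Import structures.
From mathcomp Require Import all_boot all_algebra all_fingroup.
From mathcomp Require Import generic_quotient ring_quotient finfield.
From mathcomp Require Import boolp mpoly.

Set Implicit Arguments.
Unset Strict Implicit.
Unset Printing Implicit Defensive.

Import GRing.Theory.
Local Open Scope ring_scope.
Local Open Scope quotient_scope.

(* The ideal (X_k ^ p - X_k)_k of F_p[X_0, ..., X_(N-1)]. *)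
Definition frob_ideal (p N : nat) : {pred {mpoly 'F_p[N]}} :=
  fun P => `[< exists c : 'I_N -> {mpoly 'F_p[N]},
                 P = \sum_(k < N) c k * ('X_k ^+ p - 'X_k) >].

Lemma frob_idealr_closed p N : idealr_closed (@frob_ideal p N).
Proof.
split.
- by apply/asboolP; exists (fun=> 0); rewrite big1 // => k _; rewrite mul0r.
- apply/asboolP => -[c /(congr1 (meval (fun=> 1)))].
  rewrite meval1 raddf_sum big1 => [/eqP|k _]; first by rewrite oner_eq0.
  by rewrite /= mevalM mevalB rmorphXn /= mevalXU expr1n subrr mulr0.
- move=> a _ _ /asboolP[c ->] /asboolP[d ->]; apply/asboolP.
  exists (fun k => a * c k + d k); rewrite mulr_sumr -big_split /=.
  by apply: eq_bigr => k _; rewrite mulrDl mulrA.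
Qed.

HB.instance Definition _ p N :=
  isIdealr.Build {mpoly 'F_p[N]} (@frob_ideal p N) (@frob_idealr_closed p N).

(* F_p[X_0, ..., X_(N-1)] / (X_k ^ p - X_k)_k *)
Notation redpoly p N := {ideal_quot (@frob_ideal p N)}.

Section RedPoly.
Variables p N : nat.

Definition red (P : {mpoly 'F_p[N]}) : redpoly p N := \pi P.

Definition rvar (k : 'I_N) : redpoly p N := red 'X_k.

Definition rcst (c : 'F_p) : redpoly p N := red c%:MP.

(* The subring generated over F_p by the variables indexed by D. *)
Definition polys_in (D : {set 'I_N}) (g : redpoly p N) : Prop :=
  exists2 P : {mpoly 'F_p[N]}, red P = g
    & forall mon, mon \in msupp P -> forall k, mon k != 0%N -> k \in D.

Definition reval (g : redpoly p N) (v : 'rV['F_p]_N) : 'F_p :=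
  (repr g).@[v 0].

Lemma red_eqP (P Q : {mpoly 'F_p[N]}) :
  reflect (red P = red Q) (P - Q \in @frob_ideal p N).
Proof. by rewrite Quotient.idealrBE; apply: (iffP eqP). Qed.

Lemma reval_red (P : {mpoly 'F_p[N]}) v :
  prime p -> reval (red P) v = P.@[v 0].
Proof.
move=> pr_p; apply/eqP; rewrite -subr_eq0 -mevalB.
have /red_eqP/asboolP[c ->] : red (repr (red P)) = red P by rewrite /red reprK.
rewrite raddf_sum big1 // => k _.
rewrite /= mevalM mevalB rmorphXn /= mevalXU.
have := expf_card (v 0 k); rewrite card_Fp // => ->.
by rewrite subrr mulr0.
Qed.

End RedPoly.

(* The binomial coefficient of an integer m; the division is exact. *)
Definition binz (m : int) (k : nat) : int :=
  ((\prod_(l < k) (m - (l : nat)%:Z)) %/ (k`!)%:Z)%Z.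

Lemma prod_ffact (m k : nat) :
  \prod_(l < k) (m%:Z - (l : nat)%:Z) = (m ^_ k)%:Z.
Proof.
elim: k => [|k IHk]; first by rewrite big_ord0 ffactn0.
rewrite big_ord_recr /= IHk ffactnSr.
have [le_km|lt_mk] := leqP k m; first by rewrite subzn // -PoszM.
by rewrite ffact_small // mul0r mul0n.
Qed.

Lemma binz_nat (m k : nat) : binz m k = 'C(m, k).
Proof.
by rewrite /binz prod_ffact -bin_ffact PoszM mulzK // eqz_nat -lt0n fact_gt0.
Qed.

Lemma binz_exact (m : int) (k : nat) :
  binz m k * (k`!)%:Z = \prod_(l < k) (m - (l : nat)%:Z).
Proof.
rewrite /binz divzK //; case: m => [m|a].
  by rewrite prod_ffact -bin_ffact PoszM dvdz_mull.
have -> : \prod_(l < k) (Negz a - (l : nat)%:Z) =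
          (-1) ^+ k * ((a + k) ^_ k)%:Z.
  elim: k => [|k IHk]; first by rewrite big_ord0 ffactn0.
  rewrite big_ord_recr /= IHk addnS ffactSS exprS NegzE PoszM.
  rewrite -opprD -PoszD addSn mulrN !mulN1r mulNr; congr (- _).
  by rewrite -mulrA; congr (_ * _); rewrite mulrC.
by rewrite -bin_ffact PoszM mulrA dvdz_mull.
Qed.

(* S_n R_n = F_p[Q_0, ..., Q_(n-1), x_1, ..., x_n]: the first n variables are
   the Q_j, the last n are the x_l.  Both S_i and R_j have bases of reduced
   monomials, so for i, j <= n the tensor product S_i R_j is the subring
   generated by Q_0, ..., Q_(i-1), x_1, ..., x_j. *)
Notation SRring p n := (redpoly p (n + n)).

Section Flows.
Variables p n : nat.

(* B(V_1, ..., V_n): the tuples (x_1 + g_1, ..., x_n + g_n) with g_i in V_i.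
   Indices start at 0, so V i stands for V_(i+1). *)
Definition triangular (A : nmodType) (x : 'I_n -> A) (V : 'I_n -> A -> Prop)
    (s : 'I_n -> A) : Prop :=
  exists2 g : 'I_n -> A, (forall i, V i (g i)) & (forall i, s i = x i + g i).

(* R_j, as the subring F_p[x_1, ..., x_j] of R_n. *)
Definition Rsub (j : nat) : redpoly p n -> Prop :=
  polys_in [set l : 'I_n | (l < j)%N].

(* The map F_p^n -> F_p^n given by a tuple of elements of R_n. *)
Definition tuple_map (f : 'I_n -> redpoly p n) (v : 'rV['F_p]_n) :
    'rV['F_p]_n := \row_i reval (f i) v.

(* The group B_n(F_p). *)
Definition Bgroup (s : {perm 'rV['F_p]_n}) : Prop :=
  exists2 f : 'I_n -> redpoly p n,
    triangular (@rvar p n) (fun i => Rsub i) f & s =1 tuple_map f.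

Local Notation SRring := (SRring p n).

Definition Qvar (j : 'I_n) : SRring := rvar p (lshift n j).
Definition xvar (l : 'I_n) : SRring := rvar p (rshift n l).

Definition SR (i j : nat) : SRring -> Prop :=
  polys_in [set k : 'I_(n + n) |
              match split k with inl q => (q < i)%N | inr l => (l < j)%N end].

(* S_i R_i + F_p Q_i; with indices starting at 1 this is W_(i+1). *)
Definition W (i : 'I_n) (g : SRring) : Prop :=
  exists2 h, SR i i h & exists c : 'F_p, g = h + rcst (n + n) c * Qvar i.

Definition Qval (m : int) (j : nat) : 'F_p := (binz m (p ^ j))%:~R.

Definition subst_Q (m : int) : (n + n).-tuple {mpoly 'F_p[n]} :=
  [tuple match split k with
         | inl j => (Qval m j)%:MP
         | inr l => 'X_l
         end | k < n + n].

Definition phi (m : int) (g : SRring) : redpoly p n :=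
  red (repr g \mPo subst_Q m).

Lemma phi_red (m : int) (P : {mpoly 'F_p[n + n]}) :
  prime p -> phi m (red P) = red (P \mPo subst_Q m).
Proof.
move=> pr_p; apply/red_eqP; rewrite -comp_mpolyB.
have /red_eqP/asboolP[c ->] : red (repr (red P)) = red P by rewrite /red reprK.
rewrite raddf_sum /=; apply: rpred_sum => k _.
rewrite rmorphM rmorphB rmorphXn /= comp_mpolyXU -tnth_nth tnth_mktuple.
apply: idealMr; case: (split k) => j.
  have := expf_card (Qval m j); rewrite card_Fp // => Qp.
  by rewrite -rmorphXn /= Qp subrr rpred0.
apply/asboolP; exists (fun l => (l == j)%:R).
rewrite (bigD1 j) //= eqxx mul1r big1 ?addr0 // => l /negbTE->.
by rewrite mul0r.
Qed.

Definition Zflow (s : {perm 'rV['F_p]_n}) (sT : 'I_n -> SRring) : Prop :=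
  forall m : nat, tuple_map (fun i => phi m (sT i)) =1 (s ^+ m)%g.

End Flows.

(* Main.v *)
(* By Lagrange interpolation the elements of a reduced polynomial ring are the
   functions on F_p^N, and they lie in the subring generated by some of the
   variables exactly when they depend only on these variables.  By Lucas,
   Q_j(m) is the j-th base-p digit of m, so everything reduces to the identity
   G_i(m, x) = floor(m / p^i) c_i + G_i(m mod p^i, x) with c_i constant, where
   s^m moves the coordinate x_i by G_i(m, x) = \sum_(k < m) g_i(s^k x) (indices
   from 0).  Here s^(p^i) fixes the first i coordinates and c_i is G_i(p^i, x):
   it is invariant under s, hence constant if s is transitive on these
   coordinates, and otherwise it is zero because a shorter period p^(i-1)
   repeats p times. *)
From HB Require Import structures.
Require Import Defs.
From mathcomp Require Import all_boot all_algebra all_fingroup.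
From mathcomp Require Import generic_quotient ring_quotient finfield.
From mathcomp Require Import boolp mpoly.

Set Implicit Arguments.
Unset Strict Implicit.
Unset Printing Implicit Defensive.

Import GRing.Theory.
Local Open Scope ring_scope.
Local Open Scope quotient_scope.

(** * Lagrange interpolation: reduced polynomials as functions on [F_p^N] *)

Section Interpolation.
Variables (p N : nat).
Hypothesis pr_p : prime p.
Implicit Types (P : {mpoly 'F_p[N]}) (g h : redpoly p N) (D : {set 'I_N}).

HB.instance Definition _ :=
  GRing.RMorphism.copy (@red p N) (\pi_(redpoly p N)).

Lemma red_repr g : red (repr g) = g.
Proof. by rewrite /red reprK. Qed.

Lemma Fp_eq0E (x : 'F_p) : 1 - x ^+ p.-1 = (x == 0)%:R.
Proof.
have [->|nz_x] := eqVneq x 0.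
  by rewrite expr0n; case: p pr_p => [|[|q]] //= _; rewrite subr0.
apply/eqP; rewrite subr_eq0; apply/eqP/(mulfI nz_x).
rewrite -exprS prednK ?prime_gt0 // mulr1.
by have := expf_card x; rewrite card_Fp.
Qed.

(** The difference of the two sides has degree below [p] and vanishes at all [p] elements of
    [F_p]. *)
Lemma sum_indicator_poly :
  \sum_(c : 'F_p) (1 - ('X - c%:P) ^+ p.-1) = 1 :> {poly 'F_p}.
Proof.
apply/eqP; rewrite -subr_eq0; set Q := _ - _.
apply/eqP; apply: (@roots_geq_poly_eq0 _ _ (enum 'F_p)).
- apply/allP => x _; rewrite /root /Q !hornerE horner_sum (bigD1 x) //= big1.
    by rewrite !hornerE Fp_eq0E subrr eqxx subrr.
  by move=> c ne_cx; rewrite !hornerE Fp_eq0E subr_eq0 eq_sym (negbTE ne_cx).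
- exact: enum_uniq.
- rewrite -cardE card_Fp //.
  have sz1 : (size (1%R : {poly 'F_p}) <= p)%N.
    by rewrite size_polyC oner_eq0; apply: prime_gt0.
  apply: leq_trans (size_polyD _ _) _; rewrite geq_max size_polyN sz1 andbT.
  apply: (big_ind (fun R : {poly 'F_p} => size R <= p)%N) => [|R S sR sS|c _].
  + by rewrite size_poly0.
  + by apply: leq_trans (size_polyD _ _) _; rewrite geq_max sR sS.
  + apply: leq_trans (size_polyD _ _) _; rewrite geq_max size_polyN sz1.
    by rewrite size_exp_XsubC prednK ?leqnn // prime_gt0.
Qed.

Definition indicator_mpoly (a : {ffun 'I_N -> 'F_p}) : {mpoly 'F_p[N]} :=
  \prod_k (1 - ('X_k - (a k)%:MP) ^+ p.-1).

(** By distributivity this is a product over [k] of sums over [F_p]; each factor is the one-variable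
    identity evaluated at [X_k]. *)
Lemma sum_indicator_mpoly : \sum_a indicator_mpoly a = 1.
Proof.
rewrite -(bigA_distr_bigA (fun k c => 1 - ('X_k - c%:MP_[N]) ^+ p.-1)).
rewrite big1 // => k _.
pose ev (Q : {poly 'F_p}) := (map_poly (@mpolyC N 'F_p) Q).['X_k].
transitivity (\sum_(c : 'F_p) ev (1 - ('X - c%:P) ^+ p.-1)).
  apply: eq_bigr => c _.
  by rewrite /ev rmorphB rmorphXn rmorphB /= rmorph1 map_polyX map_polyC !hornerE.
by rewrite /ev -horner_sum -rmorph_sum sum_indicator_poly rmorph1 hornerC.
Qed.

Lemma meval_indicator (a : {ffun 'I_N -> 'F_p}) (v : 'I_N -> 'F_p) :
  (indicator_mpoly a).@[v] = \prod_k (v k == a k)%:R.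
Proof.
rewrite rmorph_prod; apply: eq_bigr => k _.
rewrite /= mevalB meval1 rmorphXn /= mevalB mevalXU mevalC.
by rewrite Fp_eq0E subr_eq0.
Qed.

Lemma frob_mem (k : 'I_N) : 'X_k ^+ p - 'X_k \in @frob_ideal p N.
Proof.
apply/asboolP; exists (fun l => (l == k)%:R).
rewrite (bigD1 k) //= eqxx mul1r big1 ?addr0 // => l /negbTE->.
by rewrite mul0r.
Qed.

(** Next to the indicator of [a], each [X_k] may be replaced by [a_k]: by Frobenius,
    [(X_k - a_k) (1 - (X_k - a_k)^(p-1))] equals [-(X_k^p - X_k)], which lies in the ideal. *)
Lemma red_mul_indicator P (a : {ffun 'I_N -> 'F_p}) :
  red P * red (indicator_mpoly a) = red (P.@[a]%:MP * indicator_mpoly a).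
Proof.
have redX k : red 'X_k * red (indicator_mpoly a) =
    red (a k)%:MP * red (indicator_mpoly a).
  apply/eqP; rewrite -!rmorphM; apply/eqP/red_eqP.
  rewrite -mulrBl /indicator_mpoly (bigD1 k) //= mulrA mulrC; apply: idealMr.
  rewrite mulrBr mulr1 -exprS prednK ?prime_gt0 //.
  have pchar : p \in [pchar {mpoly 'F_p[N]}].
    apply/andP; split=> //; have := pchar_Fp pr_p.
    by case/andP=> _ /eqP h; rewrite -mpolyC_nat h.
  have := expf_card (a k); rewrite card_Fp // => ap.
  rewrite -(pFrobenius_autE pchar) pFrobenius_autB_comm; last exact: mulrC.
  rewrite !pFrobenius_autE -rmorphXn /= ap.
  have -> : 'X_k - (a k)%:MP - ('X_k ^+ p - (a k)%:MP) =
      - ('X_k ^+ p - 'X_k) :> {mpoly 'F_p[N]}.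
    by rewrite !opprB addrA subrK.
  by rewrite rpredN frob_mem.
elim/mpolyind: P => [|c m P _ _ IHP]; first by rewrite meval0 mpolyC0 !(mul0r, rmorph0).
rewrite mevalD rmorphD mulrDl IHP mpolyCD mulrDl rmorphD; congr (_ + _).
rewrite mevalZ mevalX -mul_mpolyC mpolyCM -mulrA 3!rmorphM /= -mulrA; congr (_ * _).
move: (red _) redX => d redX.
rewrite mpolyXE_id !rmorph_prod /=.
elim/big_ind2: _ => [|x1 x2 y1 y2 e1 e2|k _].
- by [].
- by rewrite -mulrA e2 mulrCA e1 mulrCA mulrA.
- elim: (m k) => [|e IHe]; first by rewrite !expr0 rmorph1.
  by rewrite !exprS !rmorphM /= -!mulrA IHe mulrCA redX mulrCA.
Qed.

Definition interpolate (f : 'rV['F_p]_N -> 'F_p) : {mpoly 'F_p[N]} :=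
  \sum_(a : {ffun 'I_N -> 'F_p}) (f (\row_k a k))%:MP * indicator_mpoly a.

Lemma red_interpolate P : red P = red (interpolate (fun v => P.@[v 0])).
Proof.
(* Multiply [P] by 1, written as the sum of all indicators. *)
rewrite -[LHS]mulr1 -[1 in LHS](rmorph1 (@red p N)) -sum_indicator_mpoly.
rewrite /interpolate !rmorph_sum mulr_sumr; apply: eq_bigr => a _.
rewrite red_mul_indicator; congr (red (_%:MP * _)).
by apply: meval_eq => k; rewrite mxE.
Qed.

Lemma reval_inj g h : reval g =1 reval h -> g = h.
Proof.
rewrite -[g]red_repr -[h]red_repr => eq_gh; rewrite red_interpolate [RHS]red_interpolate.
congr red; apply: eq_bigr => a _; congr (_%:MP * _).
by rewrite -!(reval_red _ _ pr_p).
Qed.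

Lemma reval_interpolate f v : reval (red (interpolate f)) v = f v.
Proof.
rewrite reval_red // /interpolate raddf_sum /= (bigD1 [ffun k => v 0 k]) //=.
rewrite big1 ?addr0 => [|a ne_av].
  rewrite mevalM mevalC meval_indicator big1 ?mulr1 => [|k _].
    by congr f; apply/rowP => k; rewrite !mxE ffunE.
  by rewrite ffunE eqxx.
have [k ne_k] : exists k, a k != v 0 k.
  apply/existsP; apply: contraNT ne_av => /existsPn eq_av.
  by apply/eqP/ffunP => k; rewrite ffunE; apply/eqP; move: (eq_av k); rewrite negbK.
rewrite mevalM meval_indicator (bigD1 k) //= eq_sym (negbTE ne_k).
by rewrite mul0r mulr0.
Qed.

Lemma revalD g h v : reval (g + h) v = reval g v + reval h v.
Proof.
by rewrite -{1}[g]red_repr -{1}[h]red_repr -rmorphD reval_red // mevalD.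
Qed.

Lemma revalM g h v : reval (g * h) v = reval g v * reval h v.
Proof.
by rewrite -{1}[g]red_repr -{1}[h]red_repr -rmorphM reval_red // mevalM.
Qed.

Lemma polys_inP D g :
  polys_in D g <->
  forall u v : 'rV_N, {in D, u 0 =1 v 0} -> reval g u = reval g v.
Proof.
split=> [[P <- suppP] u v eq_uv|dep_g].
  rewrite !reval_red // !mevalE !big_seq; apply: eq_bigr => m /suppP Dm.
  congr (_ * _); apply: eq_bigr => k _.
  by have [->|/Dm/eq_uv->] := eqVneq (m k) 0%N; rewrite ?expr0.
pose inD (m : 'X_{1..N}) := [forall k, (m k != 0%N) ==> (k \in D)].
(* Only the monomials in variables of [D] are kept. No value changes: setting the other variables to
   0, which [dep_g] allows, kills the remaining monomials. *)
pose P := \sum_(m <- msupp (repr g) | inD m) (repr g)@_m *: 'X_[m].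
exists P => [|m].
  apply: reval_inj => v; rewrite reval_red //.
  rewrite (dep_g v (\row_k if k \in D then v 0 k else 0)); last first.
    by move=> k Dk; rewrite mxE Dk.
  rewrite /reval [RHS]mevalE /P raddf_sum [RHS](bigID inD) /=.
  rewrite [X in _ = _ + X]big1 ?addr0.
    apply: eq_bigr => m /forallP Dm; rewrite mevalZ mevalX; congr (_ * _).
    apply: eq_bigr => k _; rewrite mxE; have := Dm k.
    by case: (m k) => [|d] /=; rewrite ?expr0 // => ->.
  move=> m /forallPn[k]; rewrite negb_imply => /andP[mk nDk].
  by rewrite (bigD1 k) //= mxE (negbTE nDk) expr0n (negbTE mk) mul0r mulr0.
rewrite mcoeff_msupp /P raddf_sum /= => nz k mk; apply/idPn => nDk.
move: nz; rewrite big1 ?eqxx // => m' /forallP Dm'.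
rewrite mcoeffZ mcoeffX; have [e|] := eqVneq m' m; last by rewrite mulr0.
by have := Dm' k; rewrite e mk (negbTE nDk).
Qed.

End Interpolation.

(** * Base-[p] digits and the values of [Q_j] *)

Section Digits.
Variable p : nat.
Hypothesis pr_p : prime p.

(** With [q = p^j], adding [q] to [m] raises [C(m, q)] by 1 modulo [p]: in Vandermonde's sum only
    the two end terms survive. *)
Lemma Qval_nat (m j : nat) : Qval p m j = (m %/ p ^ j)%:R.
Proof.
rewrite /Qval binz_nat; set q := (p ^ j)%N; rewrite -[LHS]/('C(m, q)%:R).
have q_gt0 : (0 < q)%N by rewrite expn_gt0 prime_gt0.
rewrite {1}(divn_eq m q); elim: (m %/ q)%N => [|a IHa].
  by rewrite mul0n add0n bin_small ?ltn_pmod.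
rewrite mulSn -addnA -binomial.Vandermonde natr_sum.
rewrite (bigD1 ord0) // (bigD1 ord_max) /=; last by rewrite -val_eqE /= -lt0n.
rewrite big1 => [|k /andP[]]; last first.
  rewrite -!val_eqE -lt0n /= => k_gt0 ne_kq.
  have lt_kq : (k < q)%N by rewrite ltn_neqAle ne_kq -ltnS ltn_ord.
  apply/eqP; rewrite natrM mulf_eq0 -(dvdn_pcharf (pchar_Fp pr_p)).
  apply/orP; left; apply: contraTT lt_kq => ndvd; rewrite -leqNgt.
  (* If [p] did not divide [C(q, k)], then [k C(q, k) = q C(q-1, k-1)] would force [q] to divide
     [k]. *)
  apply: dvdn_leq => //; rewrite -(@Gauss_dvdl q k 'C(q, k)).
    have -> : (k * 'C(q, k) = q * 'C(q.-1, k.-1))%N.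
      by rewrite mul_bin_diag prednK.
    exact: dvdn_mulr.
  by rewrite coprimeXl // prime_coprime.
by rewrite !bin0 binn !mul1n subn0 subnn bin0 addr0 IHa natr1.
Qed.

Definition num (d : nat -> nat) (i : nat) : nat := (\sum_(j < i) d j * p ^ j)%N.

Section Num.
Variable d : nat -> nat.
Hypothesis d_lt : forall j, (d j < p)%N.

Lemma numS i : num d i.+1 = (num d i + d i * p ^ i)%N.
Proof. by rewrite /num big_ord_recr. Qed.

Lemma num_lt i : (num d i < p ^ i)%N.
Proof.
elim: i => [|i IHi]; first by rewrite /num big_ord0.
rewrite numS expnS; apply: (@leq_trans (p ^ i + d i * p ^ i)%N).
  by rewrite ltn_add2r.
by rewrite -mulSn leq_mul2r d_lt orbT.
Qed.

Lemma num_mod i k : (i <= k)%N -> (num d k %% p ^ i)%N = num d i.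
Proof.
elim: k => [|k IHk]; first by rewrite leqn0 => /eqP ->; rewrite modn_small ?num_lt.
rewrite leq_eqVlt => /predU1P[->|]; first by rewrite modn_small ?num_lt.
rewrite ltnS => le_ik; rewrite numS -modnDmr.
by rewrite -(subnK le_ik) expnD mulnA modnMl addn0 subnK // IHk.
Qed.

Lemma num_div_mod j k : (j < k)%N -> (num d k %/ p ^ j %% p)%N = d j.
Proof.
move=> lt_jk; have p_gt0 := prime_gt0 pr_p.
rewrite (divn_eq (num d k) (p ^ j.+1)) num_mod // numS expnSr.
rewrite [(p ^ j * p)%N]mulnC mulnA addnCA -mulnDl.
rewrite divnDMl ?expn_gt0 ?p_gt0 // divn_small ?num_lt // add0n.
by rewrite modnMDl modn_small.
Qed.

End Num.

Lemma num_modn m i : num (fun j => m %/ p ^ j %% p)%N i = (m %% p ^ i)%N.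
Proof.
have d_lt j : (m %/ p ^ j %% p < p)%N by rewrite ltn_pmod ?prime_gt0.
elim: i => [|i IHi]; first by rewrite /num big_ord0 modn1.
have := num_lt d_lt i.+1; rewrite numS IHi => lt_num.
rewrite [in RHS](divn_eq m (p ^ i)) [in RHS](divn_eq (m %/ p ^ i) p) mulnDl -mulnA.
by rewrite -expnS -addnA modnMDl [RHS]modn_small addnC.
Qed.

End Digits.

(** * Iterates of a triangular permutation *)

Section Dynamics.
Variables (p n : nat) (s : {perm 'rV['F_p]_n}) (f : 'I_n -> 'rV['F_p]_n -> 'F_p).
Hypothesis pr_p : prime p.
Implicit Types (x y : 'rV['F_p]_n) (i : 'I_n).

Definition eq_upto (j : nat) x y := forall l : 'I_n, (l < j)%N -> x 0 l = y 0 l.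

Hypothesis f_dep : forall i x y, eq_upto i x y -> f i x = f i y.
Hypothesis sE : forall x i, s x 0 i = x 0 i + f i x.

Definition drift i (m : nat) x := \sum_(k < m) f i ((s ^+ k)%g x).

Lemma permX_drift m x i : (s ^+ m)%g x 0 i = x 0 i + drift i m x.
Proof.
elim: m => [|m IHm]; first by rewrite /drift big_ord0 addr0 expg0 perm1.
by rewrite expgSr permM sE IHm /drift big_ord_recr addrA.
Qed.

Lemma driftD i a b x : drift i (a + b) x = drift i a x + drift i b ((s ^+ a)%g x).
Proof.
rewrite /drift big_split_ord /=; congr (_ + _).
by apply: eq_bigr => k _; rewrite expgD permM.
Qed.

Lemma eq_upto_sym j x y : eq_upto j x y -> eq_upto j y x.
Proof. by move=> e l lt_lj; rewrite e. Qed.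

Lemma eq_upto_trans j x y z : eq_upto j x y -> eq_upto j y z -> eq_upto j x z.
Proof. by move=> e e' l lt_lj; rewrite e // e'. Qed.

Lemma eq_uptoW j k x y : (j <= k)%N -> eq_upto k x y -> eq_upto j x y.
Proof. by move=> le_jk e l lt_lj; apply: e; apply: leq_trans le_jk. Qed.

Lemma eq_upto_permX j m x y : eq_upto j x y ->
  eq_upto j ((s ^+ m)%g x) ((s ^+ m)%g y).
Proof.
move=> e; elim: m => [|m IHm] l lt_lj; first by rewrite expg0 !perm1 e.
rewrite expgSr !permM !sE IHm //; congr (_ + _); apply: f_dep.
exact: (eq_uptoW (ltnW lt_lj)).
Qed.

Lemma drift_dep i m x y : eq_upto i x y -> drift i m x = drift i m y.
Proof. by move=> e; apply: eq_bigr => k _; apply/f_dep/eq_upto_permX. Qed.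

Lemma drift_period i q a m x : (forall y, eq_upto i ((s ^+ q)%g y) y) ->
  drift i (a * q + m) x = drift i q x *+ a + drift i m x.
Proof.
move=> per; elim: a => [|a IHa]; first by rewrite mul0n add0n mulr0n add0r.
by rewrite mulSn -addnA driftD (drift_dep _ (per x)) IHa mulrS addrA.
Qed.

Definition transitive_upto j := forall x y, exists m, eq_upto j ((s ^+ m)%g x) y.

(** The drift over [m + q] steps from [x] can be split after [m] or after [q] steps. Comparing the
    two shows that the drift over a period is the same at [x] and at [s^m x]. *)
Lemma drift_const i q : (forall x, eq_upto i ((s ^+ q)%g x) x) ->
  transitive_upto i -> forall x y, drift i q x = drift i q y.
Proof.
move=> per trans x y; have [m /(drift_dep q) <-] := trans x y.
apply: (addrI (drift i m x)); rewrite -driftD addnC driftD addrC.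
by congr (_ + _); apply/drift_dep/eq_upto_sym/per.
Qed.

(* As long as the drifts over a full period are nonzero constants, the action on
   the leading coordinates is transitive; once one of them vanishes, s ^+ p ^ j.-1
   already fixes these coordinates, so all later drifts are multiples of p. *)
Lemma period_alternative j : (j <= n)%N ->
  (forall x, eq_upto j ((s ^+ (p ^ j))%g x) x) /\
  (transitive_upto j \/
   (0 < j)%N /\ forall x, eq_upto j ((s ^+ (p ^ j.-1))%g x) x).
Proof.
have p_gt0 := prime_gt0 pr_p; elim: j => [|j IHj] lt_jn.
  by split=> [x l //|]; left=> x y; exists 0%N.
have [per alt] := IHj (ltnW lt_jn); pose i := Ordinal lt_jn.
have eq_uptoS x y : eq_upto j x y -> x 0 i = y 0 i -> eq_upto j.+1 x y.
  move=> e ei l; rewrite ltnS leq_eqVlt => /predU1P[lj|/e //].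
  by rewrite (_ : l = i) //; apply: val_inj.
have per_mul a x : eq_upto j ((s ^+ (a * p ^ j))%g x) x.
  elim: a x => [|a IHa] x; first by rewrite mul0n expg0 perm1.
  by rewrite mulSn expgD permM; apply: eq_upto_trans (IHa _) (per x).
have drift_mul a x : drift i (a * p ^ j) x = drift i (p ^ j) x *+ a.
  by rewrite -[(a * _)%N]addn0 (@drift_period i _ a 0 x per) {2}/drift big_ord0 addr0.
split=> [x|].
  rewrite expnS; apply: eq_uptoS; first exact: per_mul.
  by rewrite permX_drift drift_mul -mulr_natr (pcharf0 (pchar_Fp pr_p)) mulr0 addr0.
have stall : (forall x, drift i (p ^ j) x = 0) ->
    (0 < j.+1)%N /\ forall x, eq_upto j.+1 ((s ^+ (p ^ j.+1.-1))%g x) x.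
  move=> drift0; split=> // x; apply: eq_uptoS; first exact: per.
  by rewrite permX_drift drift0 addr0.
case: alt => [trans|[j_gt0 per']]; last first.
  right; apply: stall => x; rewrite -(prednK j_gt0) expnS -[(p * _)%N]addn0.
  rewrite (@drift_period i _ p 0 x per') {2}/drift big_ord0 addr0 -mulr_natr.
  by rewrite (pcharf0 (pchar_Fp pr_p)) mulr0.
have const x y : drift i (p ^ j) x = drift i (p ^ j) y.
  by rewrite (@drift_const i _ per trans x y).
have [c0|nz_c] := eqVneq (drift i (p ^ j) 0) 0.
  by right; apply: stall => x; rewrite (const x 0).
left=> x y; have [m e] := trans x y.
(* After [m] steps the first [j] coordinates agree with [y]. Each further [p^j] steps keep them and
   add the nonzero constant to coordinate [j], so [a] rounds close the gap. *)
set z := (s ^+ m)%g x in e; pose a : 'F_p := (y 0 i - z 0 i) / drift i (p ^ j) 0.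
exists (m + a * p ^ j)%N; rewrite expgD permM -/z; apply: eq_uptoS.
  by apply: eq_upto_trans (per_mul _ _) e.
rewrite permX_drift drift_mul (const z 0) -mulr_natr natr_Zp.
by rewrite mulrC divfK // addrC subrK.
Qed.

Lemma drift_digits i : exists c : 'F_p, forall m x,
  drift i m x = (m %/ p ^ i)%:R * c + drift i (m %% p ^ i) x.
Proof.
have [per alt] := period_alternative (ltnW (ltn_ord i)).
(* The base point 0 is arbitrary, since the drift over [p^i] steps is constant in both cases. *)
exists (drift i (p ^ i) 0) => m x.
rewrite {1}(divn_eq m (p ^ i)) (drift_period _ _ x per) mulr_natl.
congr (_ *+ _ + _); case: alt => [trans|[i_gt0 per']].
  exact: drift_const per trans x 0.
have drift0 y : drift i (p ^ i) y = 0.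
  rewrite -(prednK i_gt0) expnS -[(p * _)%N]addn0 (drift_period p 0 y per').
  rewrite {2}/drift big_ord0 addr0 -mulr_natr.
  by rewrite (pcharf0 (pchar_Fp pr_p)) mulr0.
by rewrite !drift0.
Qed.

End Dynamics.

(** * Flows as functions of the digits of [m] and the point [v] *)

Section FlowEvaluation.
Variables p n : nat.
Hypothesis pr_p : prime p.

Definition env (m : nat) (v : 'rV['F_p]_n) : 'rV['F_p]_(n + n) :=
  row_mx (\row_j Qval p m j) v.

Lemma reval_phi (m : nat) (g : SRring p n) v :
  reval (phi m g) v = reval g (env m v).
Proof.
rewrite /phi reval_red // comp_mpoly_meval; apply: meval_eq => k.
rewrite tnth_mktuple; case: split_ordP => j ->.
  by rewrite mevalC row_mxEl mxE.
by rewrite mevalXU row_mxEr.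
Qed.

(** Indexed by [nat] to serve as a digit sequence for [num]; the default 0 from index [n] on
    respects the bound on digits. *)
Definition Qdigit (w : 'rV['F_p]_(n + n)) (j : nat) : nat :=
  if insub j is Some l then w 0 (lshift n l) else 0%N.

Lemma QdigitE w (j : 'I_n) : Qdigit w j = w 0 (lshift n j).
Proof. by rewrite /Qdigit valK. Qed.

Lemma Qdigit_lt w j : (Qdigit w j < p)%N.
Proof.
rewrite /Qdigit; case: insub => [l|]; last exact: prime_gt0.
by apply: leq_trans (ltn_ord _) _; rewrite Fp_cast.
Qed.

(** Any values of the [Q_j] are the digits of some natural number, so the times [m >= 0] already
    reach every point of [F_p^(2n)]. *)
Lemma env_num w : env (num p (Qdigit w) n) (rsubmx w) = w.
Proof.
rewrite -[RHS]hsubmxK /env; congr row_mx; apply/rowP => j.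
rewrite !mxE Qval_nat // -(Fp_nat_mod pr_p) num_div_mod //; last exact: Qdigit_lt.
by rewrite QdigitE natr_Zp.
Qed.

Lemma num_Qdigit_env m v (i : 'I_n) : num p (Qdigit (env m v)) i = (m %% p ^ i)%N.
Proof.
rewrite -num_modn //; apply: eq_bigr => j _; congr (_ * _)%N.
have lt_jn : (j < n)%N := ltn_trans (ltn_ord j) (ltn_ord i).
rewrite -[j : nat]/(Ordinal lt_jn : nat) QdigitE row_mxEl mxE Qval_nat //.
by rewrite val_Fp_nat.
Qed.

Lemma num_Qdigit_dep (w w' : 'rV_(n + n)) (i : 'I_n) :
  (forall j : 'I_n, (j < i)%N -> w 0 (lshift n j) = w' 0 (lshift n j)) ->
  num p (Qdigit w) i = num p (Qdigit w') i.
Proof.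
move=> eq_ww'; apply: eq_bigr => j _; congr (_ * _)%N.
have lt_jn : (j < n)%N := ltn_trans (ltn_ord j) (ltn_ord i).
by rewrite -[j : nat]/(Ordinal lt_jn : nat) !QdigitE eq_ww' /=.
Qed.

Lemma SRP a b (g : SRring p n) :
  SR a b g <->
  forall w w' : 'rV_(n + n),
    (forall j : 'I_n, (j < a)%N -> w 0 (lshift n j) = w' 0 (lshift n j)) ->
    (forall l : 'I_n, (l < b)%N -> w 0 (rshift n l) = w' 0 (rshift n l)) ->
    reval g w = reval g w'.
Proof.
rewrite /SR polys_inP //; split=> dep w w'.
  move=> eqQ eqx; apply: dep => k; rewrite inE.
  by case: split_ordP => j ->; [apply: eqQ | apply: eqx].
move=> e; apply: dep => j lt_j; apply: e; rewrite inE.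
  by rewrite (unsplitK (inl j)).
by rewrite (unsplitK (inr j)).
Qed.

End FlowEvaluation.

(** * Construction of a flow, and the shape of every flow *)

Theorem theorem6p12 (p n : nat) (hp : prime p) (hn : (1 <= n)%N)
    (s : {perm 'rV['F_p]_n}) (hs : Bgroup s) :
  (exists sT : 'I_n -> SRring p n,
      triangular (@xvar p n) (fun i => SR i.+1 i) sT /\ Zflow s sT) /\
  (forall sT : 'I_n -> SRring p n,
      triangular (@xvar p n) (fun i => SR i.+1 i) sT -> Zflow s sT ->
      triangular (@xvar p n) (@W p n) sT).
Proof.
case: hs => f [g Rg fE] sf.
have g_dep (i : 'I_n) x y : eq_upto i x y -> reval (g i) x = reval (g i) y.
  move=> e; move: (Rg i); rewrite /Rsub polys_inP //; apply => l.
  by rewrite inE; apply: e.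
have sE x (i : 'I_n) : s x 0 i = x 0 i + reval (g i) x.
  by rewrite sf mxE fE revalD // /rvar reval_red // mevalXU.
pose G := drift s (fun i => reval (g i)).
have [c GE] : exists c : 'I_n -> 'F_p, forall i m x,
    G i m x = (m %/ p ^ i)%:R * c i + G i (m %% p ^ i)%N x.
  exact: fin_all_exists (drift_digits hp g_dep sE).
(* [H i] is [G_i(m mod p^i, x)] with [m mod p^i] read off from [Q_0, ..., Q_(i-1)]; hence it lies in
   [S_i R_i]. *)
pose H (i : 'I_n) (w : 'rV_(n + n)) := G i (num p (Qdigit w) i) (rsubmx w).
have H_dep (i : 'I_n) (w w' : 'rV_(n + n)) :
    (forall j : 'I_n, (j < i)%N -> w 0 (lshift n j) = w' 0 (lshift n j)) ->
    (forall l : 'I_n, (l < i)%N -> w 0 (rshift n l) = w' 0 (rshift n l)) ->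
  H i w = H i w'.
  move=> eqQ eqx; rewrite /H (num_Qdigit_dep eqQ).
  by apply: (drift_dep g_dep sE) => l lt_li; rewrite !mxE eqx.
have reval_flow (m : nat) (sT g' : 'I_n -> SRring p n) v i :
    (forall j, sT j = xvar p j + g' j) ->
    tuple_map (fun j => phi m (sT j)) v 0 i = v 0 i + reval (g' i) (env m v).
  move=> sTE; rewrite mxE reval_phi // sTE revalD //; congr (_ + _).
  by rewrite /xvar /rvar reval_red // mevalXU row_mxEr.
split.
  (* The term [floor(m / p^i) c_i] becomes [c_i Q_i], because [Q_i(m)] is [floor(m / p^i)] modulo
     [p]. *)
  pose g' i : SRring p n :=
    red (interpolate (fun w => H i w + c i * w 0 (lshift n i))).
  exists (fun i => xvar p i + g' i); split.
    exists g' => // i; apply/SRP => // w w' eqQ eqx.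
    rewrite !reval_interpolate // eqQ //; congr (_ + _).
    by apply: H_dep => // j lt_ji; apply: eqQ; apply: ltnW.
  move=> m v; apply/rowP => i; rewrite (permX_drift sE) (reval_flow _ _ g') //.
  rewrite reval_interpolate // -/G GE /H num_Qdigit_env // row_mxKr row_mxEl mxE.
  by congr (_ + _); rewrite Qval_nat // addrC mulrC.
move=> sT [g' _ sTE] flow; exists g' => // i.
exists (red (interpolate (H i))).
  by apply/SRP => // w w' eqQ eqx; rewrite !reval_interpolate //; apply: H_dep.
exists (c i); apply: reval_inj => // w.
rewrite revalD // revalM // reval_interpolate // /rcst /Qvar /rvar !reval_red //.
(* With [w] written as [env m v], the flow condition at time [m] determines the value of [g' i] at
   [w]: it is [G_i(m, v)]. *)
rewrite mevalC mevalXU -{1 3}(env_num hp w) row_mxEl mxE Qval_nat //.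
set m := num p _ n; set v := rsubmx w.
have := flow m v; move/(congr1 (fun u : 'rV_n => u 0 i)).
rewrite (reval_flow _ _ g') // (permX_drift sE) => /addrI ->.
(* Reducing [m] modulo [p^i] keeps its first [i] digits, which turns the remaining drift into
   [H i w]. *)
rewrite -/G GE num_mod ?(ltnW (ltn_ord i)) //; last exact: Qdigit_lt.
by rewrite addrC mulrC.
Qed.
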